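(* Let $(E,\mathcal{P})$ be a random locally convex module over $K$ with base $(\Omega,\mathcal{F},P)$, endowed with its $(\varepsilon,\lambda)$-topology, and let $G$ be an $L^0$-convex subset of $E$. If $G$ is $L^0$-convexly compact, then $G$ is almost surely bounded, i.e. for each $\|\cdot\|\in\mathcal{P}$ there exists $\xi\in L^0_+$ such that $\|g\|\le\xi$ for all $g\in G$.
   Context: $(\Omega,\mathcal{F},P)$ is a probability space, $K=\mathbb{R}$ or $\mathbb{C}$, $L^0(\mathcal{F},K)$ is the algebra of equivalence classes (modulo $P$-a.s. equality) of $K$-valued $\mathcal{F}$-measurable random variables, $L^0=L^0(\mathcal{F},\mathbb{R})$, ordered by $\xi\le\eta$ iff $\xi\le\eta$ a.s.; $L^0_+=\{\xi\in L^0:\xi\ge0\}$. An $L^0$-seminorm on an $L^0(\mathcal{F},K)$-module $E$ is a map $\|\cdot\|:E\to L^0_+$ with $\|\xi x\|=|\xi|\|x\|$ for $\xi\in L^0(\mathcal{F},K)$, $x\in E$, and $\|x+y\|\le\|x\|+\|y\|$. A random locally convex module $(E,\mathcal{P})$ over $K$ with base $(\Omega,\mathcal{F},P)$ is an $L^0(\mathcal{F},K)$-module $E$ with a family $\mathcal{P}$ of $L^0$-seminorms such that $\bigvee\{\|x\|:\|\cdot\|\in\mathcal{P}\}=0$ iff $x=\theta$ (the zero of $E$). For a finite nonempty $\mathcal{Q}\subset\mathcal{P}$ let $\|x\|_{\mathcal{Q}}=\bigvee_{\|\cdot\|\in\mathcal{Q}}\|x\|$; the $(\varepsilon,\lambda)$-topology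 is the linear topology on $E$ with local base at $\theta$ given by the sets $\{x\in E: P\{\omega:\|x\|_{\mathcal{Q}}(\omega)<\varepsilon\}>1-\lambda\}$, $\mathcal{Q}$ finite nonempty, $\varepsilon>0$, $0<\lambda<1$. A subset $G$ of $E$ is $L^0$-convex if $\xi x+(1-\xi)y\in G$ for all $x,y\in G$ and all $\xi\in L^0$ with $0\le\xi\le1$. An $L^0$-convex set $G$ is $L^0$-convexly compact if every family of $L^0$-convex subsets of $G$ which are closed (in the relative topology of $G$) and which has the finite intersection property has nonempty intersection. *)

(* Defs.v *)
From HB Require Import structures.
From mathcomp Require Import all_boot all_order all_algebra.
From mathcomp Require Import complex.
From Stdlib Require List.
From mathcomp Require Import all_classical all_reals all_analysis.

Set Implicit Arguments.
Unset Strict Implicit.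
Unset Printing Implicit Defensive.

Import Order.TTheory GRing.Theory Num.Theory.
Local Open Scope classical_set_scope.
Local Open Scope ring_scope.

(*  - The scalar field K is R (kc = false) or C = R[i] (kc = true).     *)
(*    A K-valued random variable is a function Omega -> R[i] whose real *)
(*    and imaginary parts are measurable, with imaginary part 0 when    *)
(*    K = R.                                                            *)
(*  - L^0 is the quotient modulo a.s. equality; we work with            *)
(*    representatives and state every property modulo a.s. equality.   *)

Section L0.
Context {R : realType} {d : measure_display} {Omega : measurableType d}.
Variable (P : probability Omega R).

Definition Krv (kc : bool) (xi : Omega -> R[i]) : Prop :=
  [/\ measurable_fun setT (fun w => complex.Re (xi w)),
      measurable_fun setT (fun w => complex.Im (xi w)) &
      (~~ kc -> forall w, complex.Im (xi w) = 0)].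

Definition Rrv (xi : Omega -> R) : Prop := measurable_fun setT xi.

Definition aeqK (xi eta : Omega -> R[i]) : Prop :=
  {ae P, forall w, xi w = eta w}.

Definition aele (xi eta : Omega -> R) : Prop :=
  {ae P, forall w, xi w <= eta w}.

Definition aeqR (xi eta : Omega -> R) : Prop :=
  {ae P, forall w, xi w = eta w}.

Definition L0plus (xi : Omega -> R) : Prop := Rrv xi /\ aele (fun=> 0) xi.

Definition cabs (z : R[i]) : R := Num.sqrt (complex.Re z ^+ 2 + complex.Im z ^+ 2).

Definition is_L0_sup (S : set (Omega -> R)) (s : Omega -> R) : Prop :=
  Rrv s /\ (forall f, S f -> aele f s) /\
  (forall u, Rrv u -> (forall f, S f -> aele f u) -> aele s u).

Definition kmul (xi eta : Omega -> R[i]) : Omega -> R[i] :=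
  fun w => (xi w * eta w)%R.
Definition kadd (xi eta : Omega -> R[i]) : Omega -> R[i] :=
  fun w => (xi w + eta w)%R.
Definition kone : Omega -> R[i] := fun=> 1%R.
Definition kofR (xi : Omega -> R) : Omega -> R[i] := fun w => ((xi w)%:C)%C.

Definition is_L0_module (kc : bool) (E : zmodType)
    (smul : (Omega -> R[i]) -> E -> E) : Prop :=
  [/\ (* smul only depends on the class in L^0(F,K) *)
      (forall xi eta x, Krv kc xi -> Krv kc eta -> aeqK xi eta ->
          smul xi x = smul eta x),
      (forall xi x y, Krv kc xi -> smul xi (x + y) = smul xi x + smul xi y),
      (forall xi eta x, Krv kc xi -> Krv kc eta ->
          smul (kadd xi eta) x = smul xi x + smul eta x),
      (forall xi eta x, Krv kc xi -> Krv kc eta ->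
          smul (kmul xi eta) x = smul xi (smul eta x)) &
      (forall x, smul kone x = x)].

Definition is_L0_seminorm (kc : bool) (E : zmodType)
    (smul : (Omega -> R[i]) -> E -> E) (nrm : E -> Omega -> R) : Prop :=
  [/\ (forall x, L0plus (nrm x)),
      (forall xi x, Krv kc xi ->
          aeqR (nrm (smul xi x)) (fun w => cabs (xi w) * nrm x w)) &
      (forall x y, aele (nrm (x + y)) (fun w => nrm x w + nrm y w))].

Definition is_RLC_module (kc : bool) (E : zmodType)
    (smul : (Omega -> R[i]) -> E -> E) (I : Type)
    (nrm : I -> E -> Omega -> R) : Prop :=
  [/\ is_L0_module kc smul,
      (forall i, is_L0_seminorm kc smul (nrm i)) &
      (forall x, is_L0_sup [set nrm i x | i in [set: I]] (fun=> 0) <-> x = 0)].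

(* ||x||_Q for a finite nonempty Q (given as a nonempty list) *)
Definition nrmQ (E : zmodType) (I : Type) (nrm : I -> E -> Omega -> R)
    (Q : seq I) (x : E) : Omega -> R :=
  fun w => \big[Num.max/0]_(i <- Q) nrm i x w.

Definition Unbhd (E : zmodType) (I : Type) (nrm : I -> E -> Omega -> R)
    (Q : seq I) (eps lam : R) : set E :=
  [set x | (P [set w | (nrmQ nrm Q x w < eps)%R] > (1 - lam)%:E)%E].

Definition el_open (E : zmodType) (I : Type) (nrm : I -> E -> Omega -> R)
    (O : set E) : Prop :=
  forall x, O x -> exists Q : seq I, exists eps lam : R,
    [/\ Q <> [::], 0 < eps, 0 < lam, lam < 1 &
        forall y, Unbhd nrm Q eps lam (y - x) -> O y].

Definition el_closed (E : zmodType) (I : Type) (nrm : I -> E -> Omega -> R)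
    (C : set E) : Prop := el_open nrm (~` C).

Definition rel_closed (E : zmodType) (I : Type) (nrm : I -> E -> Omega -> R)
    (G C : set E) : Prop :=
  exists C', el_closed nrm C' /\ C = C' `&` G.

Definition L0_convex (E : zmodType) (smul : (Omega -> R[i]) -> E -> E)
    (G : set E) : Prop :=
  forall x y (xi : Omega -> R), G x -> G y -> Rrv xi ->
    aele (fun=> 0) xi -> aele xi (fun=> 1) ->
    G (smul (kofR xi) x + smul (kofR (fun w => 1 - xi w)) y).

Definition L0_convexly_compact (E : zmodType) (smul : (Omega -> R[i]) -> E -> E)
    (I : Type) (nrm : I -> E -> Omega -> R) (G : set E) : Prop :=
  L0_convex smul G /\
  forall Fam : set (set E),
    (forall A, Fam A -> [/\ A `<=` G, L0_convex smul A & rel_closed nrm G A]) ->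
    (forall s : seq (set E), (forall A, List.In A s -> Fam A) ->
        exists x, G x /\ forall A, List.In A s -> A x) ->
    exists x, G x /\ forall A, Fam A -> A x.

Definition as_bounded (E : zmodType) (I : Type) (nrm : I -> E -> Omega -> R)
    (G : set E) : Prop :=
  forall i, exists xi, L0plus xi /\ forall g, G g -> aele (nrm i g) xi.

End L0.

(* Main.v *)
(* No Hahn-Banach theorem is used. If the concave minorants of a seminorm p that
   are carried by an L0-convex family of points of G were unbounded on a set B of
   positive probability, their superlevel sets would be nested L0-convex sets on
   which p tends to infinity, contradicting compactness. Suppose p is unbounded
   on G. A gliding hump then selects points x_1, x_2, ... of G, constants a_k >= k
   and a set B of positive probability with
     p (s_1 x_1 + ... + s_n x_n) >= (s_1 a_1 + ... + s_n a_n) / 2 on B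
   for all s_k >= 0. When x_1, ..., x_n are chosen, let r(w) be s_1 a_1 + ... for
   w = s_1 x_1 + ...; the concave functions y |-> sup_w (th r(w) - p (y + w)) are
   dominated on G by one random variable, hence by a constant N on most of B. So
   p (w + s y) >= th r(w) - s N for every y in G, and averaging with
   p (w + s y) >= s p(y) - p(w) shows that any y with p(y) large enough can serve
   as x_(n+1). On the convex combinations of the x_k the function r / 2 is an
   affine minorant of p, unbounded on B: a contradiction. *)

Require Import Defs.
From HB Require Import structures.
From mathcomp Require Import all_boot all_order all_algebra.
From mathcomp Require Import complex.
From mathcomp Require Import all_classical all_reals all_analysis.
From mathcomp Require Import measurable_realfun.
From mathcomp Require Import ring lra.

Set Implicit Arguments.
Unset Strict Implicit.
Unset Printing Implicit Defensive.

Import Order.TTheory GRing.Theory Num.Theory.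
Local Open Scope classical_set_scope.
Local Open Scope ring_scope.

(** * Measurable functions and probabilities of events *)

Section MeasurableFunctions.
Context {R : realType} {d : measure_display} {Omega : measurableType d}.
Implicit Types (f g : {mfun Omega >-> R}) (w : Omega).

Let mfun_addE f g w : (f + g) w = f w + g w. Proof. by []. Qed.
Let mfun_oppE f w : (- f) w = - f w. Proof. by []. Qed.
Let mfun_mulE f g w : (f * g) w = f w * g w. Proof. by []. Qed.
Let mfun_zeroE w : (0 : {mfun Omega >-> R}) w = 0. Proof. by []. Qed.
Let mfun_oneE w : (1 : {mfun Omega >-> R}) w = 1. Proof. by []. Qed.

Definition mfunE :=
  (mfun_addE, mfun_oppE, mfun_mulE, mfun_zeroE, mfun_oneE).

Lemma measurable_lef (f g : {mfun Omega >-> R}) :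
  measurable [set w | f w <= g w].
Proof.
rewrite (_ : [set _ | _] = [set: Omega] `&` [set w | f w <= g w]); last first.
  by rewrite setTI.
exact: measurable_fun_le.
Qed.

Lemma mfun_le_indic (f g : {mfun Omega >-> R}) :
  exists a : {mfun Omega >-> R}, forall o, a o = (f o <= g o)%R%:R.
Proof.
exists (mindic R (measurable_lef f g)) => o /=; rewrite mindicE.
by congr ((nat_of_bool _)%:R); apply/idP/idP => [/set_mem|/mem_set].
Qed.

(** The power function with exponent -1 supplies measurability; it agrees with the convention that
    the inverse of 0 is 0, so [s] may vanish. *)
Lemma mfun_inv_ge0 (s : {mfun Omega >-> R}) : (forall o, 0 <= s o) ->
  exists t : {mfun Omega >-> R}, forall o, t o = (s o)^-1.
Proof.
move=> s0.
have ms : measurable_fun setT (fun o => s o `^ (-1)).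
  exact: (measurableT_comp (measurable_powR (-1)) (measurable_funPT s)).
pose t : {mfun Omega >-> R} := HB.pack (fun o => s o `^ (-1))
  (isMeasurableFun.Build _ _ _ _ _ ms).
exists t => o; rewrite /t /=.
exact: powR_inv1.
Qed.

Lemma mfun_restr (B : set Omega) (f : {mfun Omega >-> R}) : measurable B ->
  exists g : {mfun Omega >-> R}, forall o, (B o -> g o = f o) /\ (~ B o -> g o = 0).
Proof.
move=> mB; exists (mindic R mB * f) => o; rewrite mfunE /= mindicE.
by split=> Bo; [rewrite mem_set// mul1r|rewrite memNset// mul0r].
Qed.

End MeasurableFunctions.

Section Probability.
Context {R : realType} {d : measure_display} {Omega : measurableType d}.
Variable (P : probability Omega R).

Definition pr (A : set Omega) : R := fine (P A).

Lemma prE (A : set Omega) : measurable A -> P A = (pr A)%:E.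
Proof. by move=> mA; rewrite fineK// fin_num_measure. Qed.

Lemma pr_le_ae (A B C : set Omega) :
  measurable A -> measurable B -> measurable C ->
  {ae P, forall w, A w -> B w \/ C w} -> pr A <= pr B + pr C.
Proof.
move=> mA mB mC [N [mN N0 sN]].
rewrite -lee_fin EFinD -!prE//.
have sub : A `<=` (B `|` C) `|` N.
  move=> w Aw; have [h|h] := pselect (B w \/ C w); first by left.
  by right; apply: sN => /= /(_ Aw).
apply: (le_trans (le_measure P _ _ sub)); rewrite ?inE//.
  by apply: measurableU => //; exact: measurableU.
apply: (@le_trans _ _ (P (B `|` C) + P N)%E).
  by apply: measureU2 => //; exact: measurableU.
by rewrite N0 adde0 measureU2.
Qed.

Lemma pr_ge0 (A : set Omega) : 0 <= pr A.
Proof. exact: fine_ge0. Qed.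

Lemma pr0 : pr set0 = 0.
Proof. by rewrite /pr measure0. Qed.

Lemma pr_sub_ae (A B : set Omega) : measurable A -> measurable B ->
  {ae P, forall w, A w -> B w} -> pr A <= pr B.
Proof.
move=> mA mB AB; rewrite -[leRHS]addr0 -pr0; apply: pr_le_ae => //.
by apply: filterS AB => w AB /AB; left.
Qed.

Lemma pr_eq0_ae (A : set Omega) : measurable A -> pr A = 0 ->
  {ae P, forall w, ~ A w}.
Proof.
by move=> mA A0; exists A; split => //; [rewrite prE// A0|move=> w /= /contrapT].
Qed.

Lemma pr_small_ae (A : set Omega) : measurable A ->
  (forall e : R, 0 < e -> pr A <= e) -> {ae P, forall w, ~ A w}.
Proof.
move=> mA A0; apply: pr_eq0_ae => //; apply/eqP; rewrite eq_le pr_ge0 andbT.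
by apply/ler_addgt0Pl => e /A0; rewrite addr0.
Qed.

Lemma pr_vanish (D : nat -> set Omega) : (forall n, measurable (D n)) ->
  (forall n, D n.+1 `<=` D n) -> (forall w, exists n, ~ D n w) ->
  forall e : R, 0 < e -> exists n, pr (D n) < e.
Proof.
move=> mD dD D0 e e0.
have capD : \bigcap_n D n = set0.
  by rewrite -subset0 => w Dw; have [n] := D0 w; apply; exact: Dw.
have PD0 : (P (D 0%N) < +oo)%E by rewrite prE ?ltry.
have nD : nonincreasing_seq D.
  by apply/nonincreasing_seqP => n; apply/subsetPset.
have := @nonincreasing_cvg_mu _ _ _ P D _ mD _ nD.
rewrite capD measure0 => /(_ PD0 measurable0).
move=> /fine_cvg/cvgr0Pnorm_lt/(_ _ e0) cv.
near \oo => n; exists n.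
by rewrite -(ger0_norm (pr_ge0 _)); near: n; exact: cv.
Unshelve. all: by end_near. Qed.

Lemma pr_tail (f : {mfun Omega >-> R}) (e : R) : 0 < e ->
  exists n : nat, pr [set w | n%:R <= f w] < e.
Proof.
apply: (@pr_vanish (fun n => [set w | n%:R <= f w])).
- by move=> n; exact: (measurable_lef (cst n%:R) f).
- by move=> n w /=; apply: le_trans; rewrite ler_nat.
- move=> w; exists (Num.truncn (f w)).+1 => /=; apply/negP.
  by rewrite -ltNge truncnS_gt.
Qed.

Lemma pr_shrink (B : set Omega) (b : R) (f : {mfun Omega >-> R}) :
  measurable B -> b < pr B ->
  exists n : nat, b < pr (B `&` [set w | f w <= n%:R]).
Proof.
move=> mB bB; have [|n nf] := @pr_tail f (pr B - b); first by rewrite subr_gt0.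
exists n; have mn := measurable_lef (cst n%:R) f.
have mn' := measurable_lef f (cst n%:R).
suff : pr B <= pr (B `&` [set w | f w <= n%:R]) + pr [set w | n%:R <= f w].
  by move: nf; lra.
apply: pr_le_ae => //; first exact: measurableI.
apply: aeW => w /= Bw; have [fn|/ltW] := leP (f w) n%:R; [by left|by right].
Qed.

(** The losses sum to at most half of [pr B], so at least the other half survives in the
    intersection. *)
Lemma pr_bigcap_gt0 (B : set Omega) (D : nat -> set Omega) :
  measurable B -> (forall n, measurable (D n)) -> 0 < pr B ->
  (forall n, pr (B `\` D n) < pr B / 2 / (2 ^ n.+1)%:R) ->
  0 < pr (B `&` \bigcap_n D n).
Proof.
move=> mB mD B0 small.
have mc : measurable (\bigcap_n D n) by exact: bigcapT_measurable.
have mU : measurable (\bigcup_n (B `\` D n)).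
  by apply: bigcupT_measurable => n; exact: measurableD.
have hU : pr (\bigcup_n (B `\` D n)) <= pr B / 2.
  rewrite -lee_fin -prE//.
  apply: le_trans (@epsilon_trick0 R (pr B / 2) xpredT _); last by lra.
  have mBD n : measurable (B `\` D n) by exact: measurableD.
  apply: (@le_trans _ _ (\sum_(n <oo) P (B `\` D n))%E).
    exact: measure_sigma_subadditive.
  apply: lee_nneseries => // n _.
  by rewrite prE ?lee_fin; [exact/ltW|exact: measurableD].
suff : pr B <= pr (B `&` \bigcap_n D n) + pr (\bigcup_n (B `\` D n)).
  by move: hU B0; lra.
apply: pr_le_ae => //; first exact: measurableI.
apply: aeW => w /= Bw.
have [h|/existsNP[n]] := pselect (forall n, D n w).
  by left; split => // n _; exact: h.
by move=> Dn; right; exists n.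
Qed.

(* The countable union [E] of members almost realizing the supremum of the
   probabilities is the essential union of the directed family. *)
Lemma directed_ess_union (F : set (set Omega)) : F !=set0 ->
  (forall A, F A -> measurable A) ->
  (forall A B, F A -> F B -> exists C,
    [/\ F C, {ae P, forall w, A w -> C w} & {ae P, forall w, B w -> C w}]) ->
  exists E, [/\ measurable E, forall A, F A -> {ae P, forall w, A w -> E w} &
    forall e : R, 0 < e -> exists2 A, F A & pr (E `\` A) < e].
Proof.
move=> [A0 FA0] mF dF.
pose c := sup [set pr A | A in F].
have hs : has_sup [set pr A | A in F].
  split; first by exists (pr A0); exists A0.
  exists 1 => _ [A FA <-]; rewrite -lee_fin -prE; last exact: mF.
  by apply: probability_le1; exact: mF.
have prc A : F A -> pr A <= c by move=> FA; apply: sup_upper_bound => //; exists A.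
have /choice[a aP] (j : nat) : exists A, F A /\ c - j.+1%:R^-1 < pr A.
  have [|_ [A FA <-] cA] := @sup_adherent _ _ j.+1%:R^-1 _ hs.
    by rewrite invr_gt0.
  by exists A.
pose E := \bigcup_j a j.
have ma j : measurable (a j) by apply: mF; exact: (aP j).1.
have mE : measurable E by exact: bigcupT_measurable.
exists E; split => //.
- move=> A FA; have mA := mF _ FA.
  suff : {ae P, forall w, ~ (A `\` E) w}.
    by apply: filterS => w h Aw; apply: contrapT => Ew; exact: h.
  apply: pr_small_ae => [|e e0]; first exact: measurableD.
  have [j je] : exists j : nat, j.+1%:R^-1 < e.
    have [j _ /(_ j (leqnn _))] := near_infty_natSinv_lt (PosNum e0).
    by exists j.
  (* [C] has probability at most [c], hence exceeds [a j] by less than 1/(j+1); so [A], almost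
     surely inside [C], exceeds [E] by less than [e]. *)
  have [C [FC AC aC]] := dF _ _ FA (aP j).1.
  have mC := mF _ FC.
  have AE : pr (A `\` E) <= pr (C `\` a j).
    apply: pr_sub_ae; [exact: measurableD..|].
    apply: filterS AC => w AC [/AC Cw Ew]; split => // aw.
    by apply: Ew; exists j.
  have CaE : pr (C `\` a j) + pr (a j) <= pr C.
    have mCa : measurable (C `\` a j) by exact: measurableD.
    have mCaU := measurableU _ _ mCa (ma j).
    have -> : pr (C `\` a j) + pr (a j) = pr ((C `\` a j) `|` a j).
      apply: EFin_inj; rewrite EFinD -!prE//.
      by symmetry; apply: measureU => //; rewrite setDE -setIA setICl setI0.
    apply: pr_sub_ae => //.
    by apply: filterS aC => w aC [[]|/aC].
  have caj := (aP j).2; have Cc := prc _ FC.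
  move: j.+1%:R^-1 je caj => x je caj.
  lra.
(* Directedness absorbs [a 0], ..., [a n] into one member, and what these sets leave of [E]
   decreases to the empty set. *)
- have /choice[u uP] (n : nat) : exists A, F A /\
      forall j, (j <= n)%N -> {ae P, forall w, a j w -> A w}.
    elim: n => [|n [A [FA ih]]].
      exists (a 0%N); split; first exact: (aP 0%N).1.
      by case=> // _; exact: aeW.
    have [C [FC AC aC]] := dF _ _ FA (aP n.+1).1.
    exists C; split => // j; rewrite leq_eqVlt => /predU1P[->//|/ih aA].
    by apply: filterS2 aA AC => w aA AC /aA/AC.
  move=> e e0.
  have [|||n ne] := @pr_vanish (fun n => E `\` \bigcup_(j in `I_n.+1) a j) _ _ _ e e0.
  + by move=> n; apply: measurableD => //; exact: bigcup_measurable.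
  + move=> n w [Ew nw]; split => //; apply: contra_not nw => -[j /= jn ajw].
    by exists j => //=; exact: ltnW.
  + move=> w; have [[j _ aj]|] := pselect (E w).
      by exists j => -[_]; apply; exists j => /=.
    by exists 0%N => -[].
  exists (u n); first exact: (uP n).1.
  apply: le_lt_trans ne; apply: pr_sub_ae.
  + by apply: measurableD => //; apply: mF; exact: (uP n).1.
  + by apply: measurableD => //; exact: bigcup_measurable.
  have : {ae P, forall w, forall j, (j <= n)%N -> a j w -> u n w}.
    apply/ae_foralln => j; have [jn|jn] := leqP j n.
      by apply: filterS ((uP n).2 j jn) => w h _.
    by apply: aeW.
  apply: filterS => w h [Ew uw]; split => // -[j /= jn /h hw].
  by apply: uw; apply: hw.
Qed.

End Probability.

(** * Directed families of random variables *)

Section Dichotomy.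
Context {R : realType} {d : measure_display} {Omega : measurableType d}.
Variable (P : probability Omega R).
Local Notation L := {mfun Omega >-> R}.
Local Notation pr := (pr P).

(** Let [E q] be the essential union of the events [q <= f]. Whether the intersection of all [E q]
    is null decides between the alternatives: off it the [E q] bound the family, while on it every
    level is almost reached by a single member. *)
Lemma dominated_or_unbounded (S : set L) : S !=set0 ->
  (forall f g, S f -> S g -> exists h, [/\ S h,
    {ae P, forall w, f w <= h w} & {ae P, forall w, g w <= h w}]) ->
  (exists M : L, forall f, S f -> {ae P, forall w, f w <= M w}) \/
  (exists B, [/\ measurable B, 0 < pr B &
     forall n : nat, exists2 f, S f & forall w, B w -> n%:R <= f w]).
Proof.
move=> [f0 Sf0] dS.
have mle (q : nat) (f : L) : measurable [set w | q%:R <= f w].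
  exact: (measurable_lef (cst q%:R) f).
have /choice[E EP] (q : nat) : exists E, [/\ measurable E,
    forall f, S f -> {ae P, forall w, q%:R <= f w -> E w} &
    forall e : R, 0 < e -> exists2 f, S f & pr (E `\` [set w | q%:R <= f w]) < e].
  have [||_ _ [f Sf <-] [g Sg <-]|E [mE SE eE]] :=
      @directed_ess_union _ _ _ P [set [set w | q%:R <= f w] | f in S].
  - by exists [set w | q%:R <= f0 w]; exists f0.
  - by move=> _ [f _ <-].
  - have [h [Sh fh gh]] := dS _ _ Sf Sg.
    exists [set w | q%:R <= h w]; split; first by exists h.
    + by apply: filterS fh => w fh /= /le_trans; apply.
    + by apply: filterS gh => w gh /= /le_trans; apply.
  exists E; split => // [f Sf|e e0]; first by apply: SE; exists f.
  by have [_ [f Sf <-] fe] := eE _ e0; exists f.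
have mE q : measurable (E q) by have [] := EP q.
pose B := \bigcap_q E q.
have mB : measurable B by exact: bigcapT_measurable.
have [B0|B0] := ltP 0 (pr B); last first.
- left.
  have {}B0 : {ae P, forall w, ~ B w}.
    by apply: pr_eq0_ae => //; apply/eqP; rewrite eq_le B0 pr_ge0.
  (* Removing [B] makes the supremum of the [g n] finite at every point: a point outside [E q] is
     outside [F n] for all n >= q. *)
  pose F n := (\bigcap_(q in `I_n.+1) E q) `\` B.
  have mF n : measurable (F n).
    by apply: measurableD => //; apply: bigcap_measurable => //; exists 0%N.
  pose g n : Omega -> R := fun w => n.+1%:R * \1_(F n) w.
  have mg n : measurable_fun setT (g n).
    by apply: measurable_funM => //; exact: measurable_indic.
  have ubg w : has_ubound (range (g^~ w)).
    have [Bw|/existsNP[q /not_implyP[_ Eq]]] := pselect (B w).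
      exists 0 => _ [n _ <-]; rewrite /g indicE memNset ?mulr0//.
      by case=> _; exact.
    exists q%:R => _ [n _ <-]; rewrite /g indicE.
    have [nq|qn] := ltnP n q.
      by case: (_ \in _); rewrite ?mulr1 ?mulr0 ?ler_nat// ler0n.
    by rewrite memNset ?mulr0// => -[Fn _]; apply: Eq; exact: (Fn q).
  have mM : measurable_fun setT (fun w => sups (g^~ w) 0).
    by apply: measurable_fun_sups.
  pose M : L := HB.pack (fun w => sups (g^~ w) 0) (isMeasurableFun.Build _ _ _ _ _ mM).
  exists M => f Sf.
  have : {ae P, forall w, forall q : nat, q%:R <= f w -> E q w}.
    by apply/ae_foralln => q; have [_ + _] := EP q; exact.
  apply: filterS2 B0 => w Bw Ef.
  have gM n : g n w <= M w.
    apply: ub_le_sup; last by exists n.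
    by have [b bP] := ubg w; exists b => _ [k _ <-]; apply: bP; exists k.
  have [f0w|f0w] := leP 0 (f w); last first.
    apply: (le_trans (ltW f0w)); apply: le_trans (gM 0%N).
    by rewrite /g mulr_ge0// indicE ler0n.
  (* With n the integer part of [f w], the factor n+1 in [g n] exceeds [f w]. *)
  have Fw : F (Num.truncn (f w)) w.
    split => // q /= qf; apply: Ef; rewrite ltnS in qf.
    by apply: (@le_trans _ _ (Num.truncn (f w))%:R); rewrite ?ler_nat ?truncn_le.
  apply: le_trans (gM (Num.truncn (f w))).
  by rewrite /g indicE mem_set// mulr1 ltW// truncnS_gt.
- right.
  (* The member [f q] reaches level q on [E q] up to a part so small that the total loss is at most
     half of [pr B]. *)
  have /choice[f fP] (q : nat) : exists f, S f /\
      pr (E q `\` [set w | q%:R <= f w]) < pr B / 2 / (2 ^ q.+1)%:R.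
    have [_ _ /(_ (pr B / 2 / (2 ^ q.+1)%:R))[|f Sf fe]] := EP q; last by exists f.
    by rewrite !divr_gt0// ltr0n expn_gt0.
  exists (B `&` \bigcap_q [set w | q%:R <= f q w]); split.
  + by apply: measurableI => //; exact: bigcapT_measurable.
  + apply: pr_bigcap_gt0 => // q.
    apply: le_lt_trans (fP q).2; apply: pr_sub_ae.
    * exact: measurableD.
    * exact: measurableD.
    * by apply: aeW => w [Bw ?]; split => //; exact: Bw.
  + by move=> n; exists (f n); [exact: (fP n).1|move=> w [_]; exact].
Qed.

End Dichotomy.

(** * Seminorms on nested-convex compact sets *)

Section ConcaveMinorants.
Context {R : realType} {d : measure_display} {Omega : measurableType d}.
Variable (P : probability Omega R).
Local Notation L := {mfun Omega >-> R}.
Local Notation pr := (pr P).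
Variable V : lmodType L.

Definition mfun_seminorm (p : V -> L) : Prop :=
  [/\ forall x, {ae P, forall w, 0 <= p x w},
      forall (a : L) x, {ae P, forall w, p (a *: x) w = `|a w| * p x w} &
      forall x y, {ae P, forall w, p (x + y) w <= p x w + p y w}].

Definition mfun_convex (C : set V) : Prop :=
  forall x y (a : L), C x -> C y -> (forall w, 0 <= a w <= 1) ->
    C (a *: x + (1 - a) *: y).

(** The only form in which compactness enters: the [C n] need not be closed, and [x] lies in all
    their closures for convergence in probability of [p]. *)
Definition nested_convex_compact (p : V -> L) (G : set V) : Prop :=
  forall C : nat -> set V,
    (forall n, [/\ C n !=set0, mfun_convex (C n), C n `<=` G & C n.+1 `<=` C n]) ->
    exists x, forall n (e : R), 0 < e ->
      exists2 c, C n c & pr [set w | e <= p (x - c) w] < e.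

Variables (p : V -> L) (G : set V).
Hypothesis p_seminorm : mfun_seminorm p.
Hypothesis G_compact : nested_convex_compact p G.

Lemma seminormN x : {ae P, forall w, p (- x) w = p x w}.
Proof.
have [_ pZ _] := p_seminorm.
apply: filterS (pZ (-1) x) => w; rewrite scaleN1r => ->.
by rewrite !mfunE normrN1 mul1r.
Qed.

Lemma seminormB x y : {ae P, forall w, p (x - y) w <= p x w + p y w}.
Proof.
have [_ _ pD] := p_seminorm.
by apply: filterS2 (pD x (- y)) (seminormN y) => w + <-.
Qed.

Lemma seminorm_leD x y : {ae P, forall w, p x w <= p (x + y) w + p y w}.
Proof. by apply: filterS (seminormB (x + y) y) => w; rewrite addrK. Qed.

(* If the minorants were unbounded on [B], the sets of [y] admitting a minorant
   at least [n] on [B] would be nested convex sets without a common limit point. *)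
Lemma concave_minorants_dominated (F : V -> L -> Prop) :
  (exists y f, F y f) ->
  (forall y f, F y f -> G y) ->
  (forall y f y' f' (a : L), F y f -> F y' f' -> (forall w, 0 <= a w <= 1) ->
    F (a *: y + (1 - a) *: y') (a * f + (1 - a) * f')) ->
  (forall y f, F y f -> {ae P, forall w, f w <= p y w}) ->
  exists M : L, forall y f, F y f -> {ae P, forall w, f w <= M w}.
Proof.
move=> [y0 [f0 F0]] FG Fconv Fp.
have [||[M MP]|[B [mB B0 BP]]] :=
    @dominated_or_unbounded _ _ _ P [set f | exists y, F y f].
- by exists f0, y0.
- move=> f g [y Fyf] [z Fzg].
  (* Pasting along the event [g <= f] turns a convex combination into the pointwise maximum. *)
  have [a aE] := mfun_le_indic g f.
  exists (a * f + (1 - a) * g); split.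
  + exists (a *: y + (1 - a) *: z); apply: Fconv => // w.
    by rewrite aE ler0n lern1 leq_b1.
  + apply: aeW => w; rewrite !mfunE aE; case: (leP (g w) (f w)) => h;
    rewrite ?mulr1n ?mulr0n; lra.
  + apply: aeW => w; rewrite !mfunE aE; case: (leP (g w) (f w)) => h;
    rewrite ?mulr1n ?mulr0n; lra.
- by exists M => y f Fyf; apply: MP; exists y.
pose C (n : nat) : set V :=
  [set y | exists2 f, F y f & {ae P, forall w, B w -> n%:R <= f w}].
have [n|x xC] := @G_compact C.
  split.
  - by have [f [y Fyf] nf] := BP n; exists y, f => //; exact: aeW.
  - move=> y z a [f Fyf nf] [g Fzg ng] a01.
    exists (a * f + (1 - a) * g); first exact: Fconv.
    apply: filterS2 nf ng => w nf ng Bw; rewrite !mfunE; have /andP[] := a01 w.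
    move: (nf Bw) (ng Bw); move: (f w) (g w) (a w) n%:R => u v b c.
    by nra.
  - by move=> y [f /FG].
  - move=> y [f Fyf nf]; exists f => //; apply: filterS nf => w nf /nf.
    by apply: le_trans; rewrite ler_nat.
(* Off an event smaller than half of [B], p x < n; yet [c] in [C n.+1] has p c >= n+1 on [B] and is
   within 1 of [x] off another such event. The two events would cover almost all of [B]. *)
have [|n xn] := @pr_tail _ _ _ P (p x) (pr B / 2); first by rewrite divr_gt0.
have e0 : 0 < Num.min 1 (pr B / 2) by rewrite lt_min ltr01 divr_gt0.
have [c [f Fcf nf] xc] := xC n.+1 _ e0.
have : pr B <= pr [set w | n%:R <= p x w] +
    pr [set w | Num.min 1 (pr B / 2) <= p (x - c) w].
  apply: pr_le_ae => //.
  - exact: (measurable_lef (cst n%:R) (p x)).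
  - exact: (measurable_lef (cst _) (p (x - c))).
  have xcB : {ae P, forall w, p c w <= p x w + p (x - c) w}.
    by apply: filterS (seminormB x (x - c)) => w; rewrite subKr.
  near=> w => Bw /=.
  have [|xnw] := leP n%:R (p x w); [by left|right].
  rewrite ge_min; apply/orP; left.
  have h1 : n.+1%:R <= f w by move: Bw; near: w.
  have h2 : f w <= p c w by near: w; exact: Fp.
  have h3 : p c w <= p x w + p (x - c) w by near: w.
  by move: h1; rewrite -natr1; lra.
have : Num.min 1 (pr B / 2) <= pr B / 2 by rewrite ge_min lexx orbT.
by move: xn xc; lra.
Unshelve. all: by end_near. Qed.

End ConcaveMinorants.

(** * The gliding hump *)

Section RayCone.
Context {R : realType} {d : measure_display} {Omega : measurableType d}.
Variable (P : probability Omega R).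
Local Notation L := {mfun Omega >-> R}.
Local Notation pr := (pr P).
Variable V : lmodType L.
Variables (p : V -> L) (G : set V).
Hypothesis p_seminorm : mfun_seminorm P p.
Hypothesis G_compact : nested_convex_compact P p G.
Hypothesis G_convex : mfun_convex G.

(* An element [T w r m] is a combination [w] of points of [G] with nonnegative
   coefficients of sum [m]; [r] is the value at [w] of the superlinear minorant
   of [p] under construction, which is comparable to [p] on [B]. *)
Record ray_cone (b : R) (T : V -> L -> L -> Prop) (B : set Omega) : Prop := {
  ray_cone0 : T 0 0 0;
  ray_coneD : forall w r m w' r' m' (a a' : L), T w r m -> T w' r' m' ->
    (forall o, 0 <= a o) -> (forall o, 0 <= a' o) ->
    T (a *: w + a' *: w') (a * r + a' * r') (a * m + a' * m');
  ray_cone_ge0 : forall w r m, T w r m -> forall o, 0 <= r o /\ 0 <= m o;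
  ray_cone_convex : forall w r m g, T w r m -> (forall o, m o <= 1) -> G g ->
    G (w + (1 - m) *: g);
  ray_cone_norm : exists th C : R, [/\ 2^-1 < th, 0 <= C &
    forall w r m, T w r m ->
      {ae P, forall o, B o -> th * r o <= p w o <= C * r o}];
  ray_cone_meas : measurable B;
  ray_cone_pr : b < pr B }.

Lemma ray_cone_trivial (b : R) (B : set Omega) : measurable B -> b < pr B ->
  ray_cone b (fun w r m => [/\ w = 0, r = 0 & m = 0]) B.
Proof.
move=> mB bB; split => //.
- move=> w r m w' r' m' a a' [-> -> ->] [-> -> ->] _ _.
  by rewrite !scaler0 !mulr0 !addr0.
- by move=> w r m [_ -> ->].
- by move=> w r m g [-> _ ->] _; rewrite subr0 scale1r add0r.
- exists 1, 0; split => //; first lra.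
  move=> w r m [-> -> _]; have [_ pZ _] := p_seminorm.
  apply: filterS (pZ 0 0) => o; rewrite scaler0 => -> _.
  by rewrite !mfunE normr0 !mul0r mulr0 lexx.
Qed.

(** On [B], th r - p (y + w) <= p w - p (y + w) <= p y, so these are minorants of [p] at [y].
    Combining [y] and [w] with the same coefficients makes the family convex, and compactness bounds
    it by one [M] for all [w] at once. *)
Lemma ray_cone_deviation (b th : R) T B : 0 <= th -> ray_cone b T B ->
  (forall w r m, T w r m -> {ae P, forall o, B o -> th * r o <= p w o}) ->
  exists M : L, forall y w r m, G y -> T w r m ->
    {ae P, forall o, B o -> th * r o - p (y + w) o <= M o}.
Proof.
move=> th0 TB thp.
have [p0 pZ pD] := p_seminorm.
have mB := ray_cone_meas TB.
(* Inequalities rather than equations, because subadditivity of [p] bounds a combination from one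
   side only; the bound 0 off [B] keeps [f] below [p y] there. *)
pose F (y : V) (f : L) := G y /\ exists w r m, T w r m /\ {ae P, forall o,
  (B o -> f o <= th * r o - p (y + w) o) /\ (~ B o -> f o <= 0)}.
have FP y w r m : G y -> T w r m -> exists2 f, F y f &
    forall o, B o -> f o = th * r o - p (y + w) o.
  move=> Gy Twrm; have [f fE] := mfun_restr (cst th * r - p (y + w)) mB.
  exists f; last by move=> o /(fE o).1; rewrite !mfunE.
  split => //; exists w, r, m; split => //; apply: aeW => o.
  by split => [/(fE o).1 ->|/(fE o).2 ->//]; rewrite !mfunE.
have [[y0 Gy0]|G0] := pselect (exists y, G y); last first.
  by exists 0 => y w r m Gy; exfalso; apply: G0; exists y.
have [||||M MP] := concave_minorants_dominated p_seminorm G_compact (F := F).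
- by have [f Ff _] := FP _ _ _ _ Gy0 (ray_cone0 TB); exists y0, f.
- by move=> y f [].
- move=> y f y' f' a [Gy [w [r [m [Tw wf]]]]] [Gy' [w' [r' [m' [Tw' wf']]]]] a01.
  have a0 o : 0 <= a o by have /andP[] := a01 o.
  have a1 o : 0 <= (1 - a) o by rewrite !mfunE; have /andP[] := a01 o; lra.
  split; first exact: G_convex.
  exists (a *: w + (1 - a) *: w'), (a * r + (1 - a) * r'), (a * m + (1 - a) * m').
  split; first exact: (ray_coneD TB).
  have -> : a *: y + (1 - a) *: y' + (a *: w + (1 - a) *: w') =
            a *: (y + w) + (1 - a) *: (y' + w').
    by rewrite !scalerDr addrACA.
  near=> o.
  have h1 : p (a *: (y + w) + (1 - a) *: (y' + w')) o <=
            p (a *: (y + w)) o + p ((1 - a) *: (y' + w')) o by near: o; exact: pD.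
  have h2 : p (a *: (y + w)) o = `|a o| * p (y + w) o by near: o; exact: pZ.
  have h3 : p ((1 - a) *: (y' + w')) o = `|(1 - a) o| * p (y' + w') o.
    by near: o; exact: pZ.
  have [h4 h5] : (B o -> f o <= th * r o - p (y + w) o) /\ (~ B o -> f o <= 0).
    by near: o.
  have [h4' h5'] : (B o -> f' o <= th * r' o - p (y' + w') o) /\ (~ B o -> f' o <= 0).
    by near: o.
  move: h1; rewrite h2 h3 !ger0_norm// => h1.
  move: (a0 o) (a1 o) h1; rewrite !mfunE => {h2 h3} u0 u1 h1.
  split=> Bo.
    by move: (ler_wpM2l u0 (h4 Bo)) (ler_wpM2l u1 (h4' Bo)) h1; lra.
  by move: (ler_wpM2l u0 (h5 Bo)) (ler_wpM2l u1 (h5' Bo)); lra.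
- move=> y f [Gy [w [r [m [Tw wf]]]]].
  near=> o.
  have [h1 h2] : (B o -> f o <= th * r o - p (y + w) o) /\ (~ B o -> f o <= 0).
    by near: o.
  have h3 : B o -> th * r o <= p w o by near: o; exact: (thp _ _ _ Tw).
  have h4 : 0 <= p y o by near: o; exact: p0.
  have h5 : p w o <= p (w + y) o + p y o by near: o; exact: (seminorm_leD p_seminorm).
  have [Bo|nBo] := pselect (B o).
    by move: (h1 Bo) (h3 Bo) h5; rewrite (addrC w y); lra.
  by move: (h2 nBo); lra.
exists M => y w r m Gy Tw.
have [f Ff fE] := FP _ _ _ _ Gy Tw.
by apply: filterS (MP _ _ Ff) => o + Bo; rewrite fE.
Unshelve. all: by end_near. Qed.

(** By homogeneity p (w + s x) is s times p (x + w / s), and w / s again belongs to the cone, so the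
    deviation bound applies to it. Where s = 0 the bound th r <= p w suffices. *)
Lemma ray_cone_perspective (b th : R) T B (M : L) : 0 <= th -> ray_cone b T B ->
  (forall w r m, T w r m -> {ae P, forall o, B o -> th * r o <= p w o}) ->
  (forall y w r m, G y -> T w r m ->
    {ae P, forall o, B o -> th * r o - p (y + w) o <= M o}) ->
  forall x w r m (s : L), G x -> T w r m -> (forall o, 0 <= s o) ->
    {ae P, forall o, B o -> th * r o - s o * M o <= p (w + s *: x) o}.
Proof.
move=> th0 TB thp MP x w r m s Gx Tw s0.
have [p0 pZ pD] := p_seminorm.
have [t tE] := mfun_inv_ge0 s0.
have t0 o : 0 <= t o by rewrite tE invr_ge0.
have Ttw := ray_coneD TB Tw Tw t0 (fun=> lexx 0 : 0 <= (0 : L) _).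
rewrite !(scale0r, mul0r, addr0) in Ttw.
near=> o => Bo.
have h1 : th * (t * r) o - p (x + t *: w) o <= M o.
  by move: Bo; near: o; exact: (MP _ _ _ _ Gx Ttw).
have h2 : th * r o <= p w o by move: Bo; near: o; exact: (thp _ _ _ Tw).
have h3 : p (s *: (x + t *: w)) o = `|s o| * p (x + t *: w) o by near: o; exact: pZ.
have h4 : p (s *: x) o = `|s o| * p x o by near: o; exact: pZ.
have h5 : p ((1 - s * t) *: w) o = `|(1 - s * t) o| * p w o by near: o; exact: pZ.
have h6 : p w o <= p (w + s *: x) o + p (s *: x) o.
  by near: o; exact: (seminorm_leD p_seminorm).
have h7 : p (s *: (x + t *: w)) o <=
    p (s *: (x + t *: w) + (1 - s * t) *: w) o + p ((1 - s * t) *: w) o.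
  by near: o; exact: (seminorm_leD p_seminorm).
(* The product s t is 1 only where s > 0; the term (1 - s t) w repairs the identity where s = 0 and
   has norm 0 elsewhere. *)
have e : s *: (x + t *: w) + (1 - s * t) *: w = w + s *: x.
  rewrite scalerDr scalerA scalerBl scale1r -addrA.
  by rewrite [X in _ + X]addrCA subrr addr0 addrC.
rewrite e h3 h5 !mfunE in h7; rewrite h4 in h6; rewrite mfunE in h1.
move: h6 h7; rewrite tE in h1 *; rewrite (ger0_norm (s0 o)).
have [so|so] := eqVneq (s o) 0.
  by rewrite so !mul0r; move: h2; lra.
rewrite divff// subrr normr0 mul0r addr0 => _.
have sp : 0 < s o by rewrite lt_def so s0.
have := ler_wpM2l (ltW sp) h1.
have -> : s o * (th * ((s o)^-1 * r o) - p (x + t *: w) o) =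
  th * r o - s o * p (x + t *: w) o by field.
by lra.
Unshelve. all: by end_near. Qed.

Definition add_ray (T : V -> L -> L -> Prop) (x : V) (c : L) (w : V) (r m : L) :=
  exists w0 r0 m0 (s : L), [/\ T w0 r0 m0, forall o, 0 <= s o, w = w0 + s *: x,
    r = r0 + s * c & m = m0 + s].

(* Averaging the bound [q >= th r - s N], which is good in [r], with the bound
   [q >= s px - C r], which is good in [s]. *)
Lemma slope_average (th th' C dl N c n r s q pw px M : R) :
  0 <= dl <= 1 -> th' <= th - dl * (th + C) -> N + th' * c <= dl * n ->
  0 <= N -> 0 <= r -> 0 <= s -> M <= N -> n <= px ->
  th * r - s * M <= q -> s * px <= q + pw -> pw <= C * r ->
  th' * (r + s * c) <= q.
Proof.
move=> /andP[dl0 dl1] hth hn N0 r0 s0 MN npx h1 h2 h3.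
have a1 : th * r - s * N <= q by have := ler_wpM2l s0 MN; lra.
have a2 : s * n - C * r <= q by have := ler_wpM2l s0 npx; lra.
have dl1' : 0 <= 1 - dl by lra.
have b1 := ler_wpM2l dl1' a1; have b2 := ler_wpM2l dl0 a2.
have b3 := ler_wpM2r r0 hth; have b4 := ler_wpM2l s0 hn.
have b5 : 0 <= dl * (s * N) by rewrite !mulr_ge0.
by lra.
Qed.

(** The deviation bound [M] is uniform over [G], so the new point [x] may be chosen after the
    constants of the lower bound, with [p x] as large as they demand. Two cuts of [B], each keeping
    more than [b], bound [M] and then [p x] from above. *)
Lemma ray_cone_step (b : R) T (B B0 : set Omega) (k : nat) :
  (forall n : nat, exists2 x, G x & {ae P, forall o, B0 o -> n%:R <= p x o}) ->
  B `<=` B0 -> ray_cone b T B -> exists T' B',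
    [/\ ray_cone b T' B', forall w r m, T w r m -> T' w r m, B' `<=` B &
      exists x r, T' x r 1 /\ forall o, k%:R <= r o].
Proof.
move=> B0P BB0 TB.
have [p0 pZ pD] := p_seminorm.
have [th [C [th2 C0 thC]]] := ray_cone_norm TB.
have th0 : 0 <= th by move: th2; lra.
have thp w r m (Tw : T w r m) : {ae P, forall o, B o -> th * r o <= p w o}.
  by apply: filterS (thC _ _ _ Tw) => o + Bo => /(_ Bo)/andP[].
have [M MP] := ray_cone_deviation th0 TB thp.
have persp := ray_cone_perspective th0 TB thp MP.
have [N NB] := pr_shrink M (ray_cone_meas TB) (ray_cone_pr TB).
have mB1 : measurable (B `&` [set o | M o <= N%:R]).
  by apply: measurableI; [exact: ray_cone_meas TB|exact: (measurable_lef M (cst N%:R))].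
(* [th'] is halfway from [th] to 1/2, so the slope stays above 1/2 at every stage; [dl] is a weight
   whose cost dl (th + C) is covered by the loss th - th'. *)
pose th' := (th + 2^-1) / 2.
pose dl := (th - th') / (th + C + 1).
have thC0 : 0 < th + C + 1 by lra.
have th'th : th' <= th by rewrite /th'; lra.
have dl0 : 0 < dl by rewrite /dl divr_gt0// /th'; lra.
have dlE : dl * (th + C + 1) = th - th' by rewrite /dl divfK// gt_eqF.
have dl1 : dl <= 1 by rewrite /dl ler_pdivrMr// /th'; lra.
(* The successor gives both c >= k and c >= 1; the latter lets the upper bound absorb p (s x) <= N'
   s into N' s c. *)
pose c : R := k.+1%:R.
have c1 : 1 <= c by rewrite /c ler1n.
pose n := (Num.truncn ((N%:R + th' * c) / dl)).+1.
have nP : N%:R + th' * c <= dl * n%:R.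
  by rewrite [dl * _]mulrC -ler_pdivrMr//; apply/ltW; exact: truncnS_gt.
have [x Gx xn] := B0P n.
have [N' N'B] := pr_shrink (p x) mB1 NB.
set B1 := _ `&` _ in mB1 N'B.
pose B2 := B1 `&` [set o | p x o <= N'%:R].
have N0 : 0 <= N%:R :> R by exact: ler0n.
have N'0 : 0 <= N'%:R :> R by exact: ler0n.
exists (add_ray T x (cst c)), B2; split.
- split.
  + exists 0, 0, 0, 0; split => //; first exact: ray_cone0 TB.
    * by rewrite scale0r addr0.
    * by rewrite mul0r addr0.
    * by rewrite addr0.
  + move=> _ _ _ _ _ _ a a' [w [r [m [s [Tw s0 -> -> ->]]]]]
      [w' [r' [m' [s' [Tw' s'0 -> -> ->]]]]] a0 a'0.
    exists (a *: w + a' *: w'), (a * r + a' * r'), (a * m + a' * m'), (a * s + a' * s').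
    split.
    * exact: (ray_coneD TB).
    * by move=> o; rewrite !mfunE addr_ge0// mulr_ge0.
    * by rewrite !scalerDr !scalerA scalerDl addrACA.
    * by rewrite !mulrDr !mulrA mulrDl addrACA.
    * by rewrite !mulrDr addrACA.
  + move=> _ _ _ [w [r [m [s [Tw s0 _ -> ->]]]]] o.
    have [r0 m0] := ray_cone_ge0 TB Tw o.
    by rewrite !mfunE !addr_ge0// mulr_ge0//= (le_trans ler01).
  + move=> _ _ _ g [w [r [m [s [Tw s0 -> _ ->]]]]] ms1 Gg.
    have m1 o : 0 <= (1 - m) o.
      by move: (ms1 o) (s0 o); rewrite !mfunE; lra.
    (* The mass 1 - m left by [w] is divided between [x] and [g], with share s / (1 - m) for [x].
       Where m = 1 also s = 0, so the value 0 of the inverse is harmless. *)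
    have [t tE] := mfun_inv_ge0 m1.
    have mtE o : (1 - m) o * (s * t) o = s o.
      rewrite !mfunE tE; have [e|ne] := eqVneq ((1 - m) o) 0.
        rewrite -[1 - m o]/((1 - m) o) e mul0r; apply/eqP.
        by move: (ms1 o) (s0 o) e; rewrite !mfunE eq_le; lra.
      by rewrite -[1 - m o]/((1 - m) o) mulrCA divff// mulr1.
    have -> : w + s *: x + (1 - (m + s)) *: g =
        w + (1 - m) *: ((s * t) *: x + (1 - s * t) *: g).
      have e : (1 - m) * (s * t) = s by apply/mfuneqP => o; rewrite mfunE mtE.
      rewrite scalerDr !scalerA e addrA; congr (_ + _ *: _).
      by rewrite mulrBr mulr1 e opprD addrA.
    apply: (ray_cone_convex TB Tw).
      by move=> o; have := m1 o; rewrite !mfunE; lra.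
    apply: G_convex => // o.
    have t0 : 0 <= t o by rewrite tE invr_ge0.
    rewrite mfunE mulr_ge0//= tE.
    have [e|ne] := eqVneq ((1 - m) o) 0; first by rewrite e invr0 mulr0.
    have m1' : 0 < (1 - m) o by rewrite lt_def ne m1.
    by rewrite ler_pdivrMr// mul1r; move: (ms1 o); rewrite !mfunE; lra.
  + exists th', (C + N'%:R); split; [by rewrite /th'; lra|by rewrite addr_ge0|].
    move=> _ _ _ [w [r [m [s [Tw s0 -> -> _]]]]].
    have sxP := seminorm_leD p_seminorm (s *: x) w; rewrite [_ + w]addrC in sxP.
    near=> o => -[[Bo MN] xN'].
    have [r0 _] := ray_cone_ge0 TB Tw o.
    have h1 : th * r o - s o * M o <= p (w + s *: x) o.
      by move: Bo; near: o; exact: persp Tw s0.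
    have /andP[_ h2] : th * r o <= p w o <= C * r o.
      by move: Bo; near: o; exact: thC Tw.
    have h3 : p (s *: x) o = `|s o| * p x o by near: o; exact: pZ.
    have h4 : p (w + s *: x) o <= p w o + p (s *: x) o by near: o; exact: pD.
    have h5 : p (s *: x) o <= p (w + s *: x) o + p w o by near: o.
    have h6 : n%:R <= p x o by move: (BB0 _ Bo); near: o.
    rewrite h3 ger0_norm// in h4 h5; rewrite !mfunE /=.
    apply/andP; split.
      apply: (@slope_average th th' C dl N%:R c n%:R (r o) (s o) _
        (p w o) (p x o) (M o)) => //.
      * by rewrite ltW.
      * by move: dlE dl0; lra.
    have h7 := ler_wpM2l (s0 o) xN'.
    have h8 : s o <= s o * c by rewrite ler_peMr.
    have h9 := ler_wpM2l N'0 h8.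
    have h10 := mulr_ge0 N'0 r0.
    have h11 : 0 <= C * (s o * c) by rewrite !mulr_ge0// (le_trans ler01).
    by rewrite !(mulrDl, mulrDr); move: h4 h2 h7 h9 h10 h11; lra.
  + by apply: measurableI => //; exact: (measurable_lef (p x) (cst N'%:R)).
  + exact: N'B.
- move=> w r m Tw; exists w, r, m, 0; split => //.
  + by rewrite scale0r addr0.
  + by rewrite mul0r addr0.
  + by rewrite addr0.
- by move=> o [[]].
- exists x, (cst c : L); split; last by move=> o /=; rewrite ler_nat.
  exists 0, 0, 0, 1; split => //.
  + exact: ray_cone0 TB.
  + by rewrite scale1r add0r.
  + by rewrite mul1r add0r.
  + by rewrite add0r.
Unshelve. all: by end_near. Qed.

(** One [b] bounds every [pr (B n)] from below, so the decreasing [B n] cannot shrink to a null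
    set. *)
Lemma ray_cone_chain (B0 : set Omega) : measurable B0 -> 0 < pr B0 ->
  (forall n : nat, exists2 x, G x & {ae P, forall o, B0 o -> n%:R <= p x o}) ->
  exists (b : R) (T : nat -> V -> L -> L -> Prop) (B : nat -> set Omega),
  [/\ 0 < b, forall n, ray_cone b (T n) (B n),
      forall n, B n.+1 `<=` B n,
      forall m n w r s, (m <= n)%N -> T m w r s -> T n w r s &
      forall n, exists x r, T n.+1 x r 1 /\ forall o, n%:R <= r o].
Proof.
move=> mB0 B00 B0P.
pose b := pr B0 / 2; have b0 : 0 < b by rewrite divr_gt0.
have bB0 : b < pr B0 by rewrite /b; lra.
pose state := {z : (V -> L -> L -> Prop) * set Omega |
  ray_cone b z.1 z.2 /\ z.2 `<=` B0}.
have /choice[next nextP] (kz : nat * state) : exists z' : state,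
    [/\ forall w r m, (sval kz.2).1 w r m -> (sval z').1 w r m,
        (sval z').2 `<=` (sval kz.2).2 &
        exists x r, (sval z').1 x r 1 /\ forall o, kz.1%:R <= r o].
  case: kz => k [[T B] /= [TB BB0]].
  have [T' [B' [T'B' TT' B'B ray]]] :=
    ray_cone_step k B0P BB0 TB.
  by exists (exist _ (T', B') (conj T'B' (subset_trans B'B BB0))).
pose st := nat_rect (fun=> state)
  (exist _ (_, B0) (conj (ray_cone_trivial mB0 bB0) (@subset_refl _ B0)))
  (fun k z => next (k, z)).
exists b, (fun n => (sval (st n)).1), (fun n => (sval (st n)).2); split => //.
- by move=> n; have [] := svalP (st n).
- by move=> n; have [] := nextP (n, st n).
- move=> m n w r s; elim: n => [|n ih]; first by rewrite leqn0 => /eqP ->.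
  rewrite leq_eqVlt => /predU1P[->//|/ih{}ih /ih].
  by have [+ _ _] := nextP (n, st n); exact.
- by move=> n; have [_ _] := nextP (n, st n).
Qed.

Theorem compact_seminorm_dominated :
  exists M : L, forall x, G x -> {ae P, forall o, p x o <= M o}.
Proof.
have [p0 pZ pD] := p_seminorm.
have [[g0 Gg0]|G0] := pselect (exists g, G g); last first.
  by exists 0 => x Gx; exfalso; apply: G0; exists x.
have [||[M MP]|[B0 [mB0 B00 B0P]]] :=
    @dominated_or_unbounded _ _ _ P [set p x | x in G].
- by exists (p g0), g0.
- move=> _ _ [x Gx <-] [y Gy <-].
  (* [z] acts as [x] on the event p y <= p x and as [y] off it; localizing by [a] and by 1 - a shows
     that p z is almost surely the larger of the two. *)
  have [a aE] := mfun_le_indic (p y) (p x).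
  pose z := a *: x + (1 - a) *: y.
  have a01 o : 0 <= a o <= 1 by rewrite aE ler0n lern1 leq_b1.
  have ax : a *: z = a *: x.
    have aa : a * a = a.
      by apply/mfuneqP => o; rewrite mfunE aE; case: (_ <= _); rewrite ?mulr1 ?mulr0.
    by rewrite /z scalerDr !scalerA mulrBr mulr1 aa subrr scale0r addr0.
  have ay : (1 - a) *: z = (1 - a) *: y.
    have aa : (1 - a) * a = 0.
      apply/mfuneqP => o; rewrite !mfunE aE.
      by case: (_ <= _); rewrite ?mulr1n ?mulr0n ?mulr0 ?subrr ?mul0r.
    have aa' : (1 - a) * (1 - a) = 1 - a by rewrite mulrBr aa mulr1 subr0.
    by rewrite /z scalerDr !scalerA aa aa' scale0r add0r.
  have xyz : {ae P, forall o, p x o <= p z o /\ p y o <= p z o}.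
    have azP := pZ a z; rewrite ax in azP.
    have a'zP := pZ (1 - a) z; rewrite ay in a'zP.
    near=> o.
    have : `|a o| * p z o = `|a o| * p x o.
      have <- : p (a *: x) o = `|a o| * p z o by near: o.
      by near: o; exact: pZ.
    have : `|(1 - a) o| * p z o = `|(1 - a) o| * p y o.
      have <- : p ((1 - a) *: y) o = `|(1 - a) o| * p z o by near: o.
      by near: o; exact: pZ.
    rewrite !mfunE aE; case: (leP (p y o) (p x o)) => h;
      rewrite ?mulr1n ?mulr0n ?subrr ?subr0 ?normr0 ?normr1; lra.
  exists (p z); split; first by exists z => //; exact: G_convex.
  + by apply: filterS xyz => o [].
  + by apply: filterS xyz => o [].
- by exists M => x Gx; apply: MP; exists x.
exfalso.
have [n|b [T [B [b0 TB dB Tmono Tray]]]] := ray_cone_chain mB0 B00.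
  by have [_ [x Gx <-] xn] := B0P n; exists x => //; exact: aeW.
pose Bi := \bigcap_n B n.
have mB n : measurable (B n) := ray_cone_meas (TB n).
have mBi : measurable Bi by exact: bigcapT_measurable.
have Bi0 : 0 < pr Bi.
  have [||| n nb] := @pr_vanish _ _ _ P (fun n => B n `\` Bi) _ _ _ b b0.
  - by move=> n; exact: measurableD.
  - by move=> n o [/dB].
  - move=> o; have [Bo|/existsNP[n /not_implyP[_ nB]]] := pselect (Bi o).
      by exists 0%N => -[].
    by exists n => -[].
  have : pr (B n) <= pr Bi + pr (B n `\` Bi).
    apply: pr_le_ae => //; first exact: measurableD.
    by apply: aeW => o Bo; have [|] := pselect (Bi o); [left|right].
  by have := ray_cone_pr (TB n); lra.
(* Total coefficient 1 puts [y] in [G], and 1/2 is a slope valid for all the cones, so on [Bi] r / 2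
   is a minorant common to all stages. *)
pose F (y : V) (f : L) := exists n r, T n y r 1 /\ {ae P, forall o,
  (Bi o -> f o <= 2^-1 * r o) /\ (~ Bi o -> f o <= 0)}.
have FP n y r : T n y r 1 -> exists2 f, F y f & forall o, Bi o -> f o = 2^-1 * r o.
  move=> Ty; have [f fE] := mfun_restr (cst 2^-1 * r) mBi.
  exists f; last by move=> o /(fE o).1.
  exists n, r; split => //; apply: aeW => o.
  by split => [/(fE o).1 ->|/(fE o).2 ->].
have [||||M MP] := concave_minorants_dominated p_seminorm G_compact (F := F).
- have [x [r [Tx _]]] := Tray 0%N; have [f Ff _] := FP _ _ _ Tx.
  by exists x, f.
- move=> y f [n [r [Ty _]]].
  have := ray_cone_convex (TB n) Ty (fun=> lexx 1) Gg0.
  by rewrite subrr scale0r addr0.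
- move=> y f y' f' a [n [r [Ty yf]]] [n' [r' [Ty' yf']]] a01.
  have a0 o : 0 <= a o by have /andP[] := a01 o.
  have a1 o : 0 <= (1 - a) o by rewrite !mfunE; have /andP[] := a01 o; lra.
  exists (maxn n n'), (a * r + (1 - a) * r'); split.
    have := ray_coneD (TB (maxn n n')) (Tmono _ _ _ _ _ (leq_maxl n n') Ty)
      (Tmono _ _ _ _ _ (leq_maxr n n') Ty') a0 a1.
    by rewrite !mulr1 [a + _]addrC subrK.
  apply: filterS2 yf yf' => o [h1 h2] [h1' h2'].
  move: (a0 o) (a1 o); rewrite !mfunE => u0 u1.
  split=> Bo.
    by move: (ler_wpM2l u0 (h1 Bo)) (ler_wpM2l u1 (h1' Bo)); lra.
  by move: (ler_wpM2l u0 (h2 Bo)) (ler_wpM2l u1 (h2' Bo)); lra.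
- move=> y f [n [r [Ty yf]]].
  have [th [C [th2 _ thC]]] := ray_cone_norm (TB n).
  near=> o.
  have [h1 h2] : (Bi o -> f o <= 2^-1 * r o) /\ (~ Bi o -> f o <= 0) by near: o.
  have h3 : 0 <= p y o by near: o; exact: p0.
  have h4 : B n o -> th * r o <= p y o <= C * r o by near: o; exact: (thC _ _ _ Ty).
  have [r0 _] := ray_cone_ge0 (TB n) Ty o.
  have [Bo|nBo] := pselect (Bi o); last by move: (h2 nBo); lra.
  have /andP[h5 _] := h4 (Bo n I).
  by move: (h1 Bo) (ler_wpM2r r0 (ltW th2)); lra.
(* On [Bi] the domination gives r <= 2 M, while stage n+1 offers r >= n; this [n] makes the event n
   <= 2 M too small to contain [Bi]. *)
have [n nM] := @pr_tail _ _ _ P (cst 2 * M) _ Bi0.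
have [x [r [Tx rn]]] := Tray n; have [f Ff fE] := FP _ _ _ Tx.
suff : pr Bi <= pr [set o | n%:R <= (cst 2 * M : L) o] by rewrite leNgt nM.
apply: pr_sub_ae => //; first exact: (measurable_lef (cst n%:R) (cst 2 * M)).
apply: filterS (MP _ _ Ff) => o fM Bo; rewrite /=.
by move: fM (rn o); rewrite fE//; move: n%:R => c; lra.
Unshelve. all: by end_near. Qed.

End RayCone.

(** * Passage to the module of the theorem *)

Section LimitPoints.
Context {R : realType} {d : measure_display} {Omega : measurableType d}.
Variable (P : probability Omega R).
Local Notation L := {mfun Omega >-> R}.
Local Notation pr := (pr P).
Variable V : lmodType L.
Variable p : V -> L.
Hypothesis p_seminorm : mfun_seminorm P p.

(** Closure for the single seminorm [p], with one [e] bounding both distance and probability. It is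
    also closed for the whole family of seminorms, whose topology is finer. *)
Definition prob_closure (C : set V) : set V := [set y | forall e : R, 0 < e ->
  exists2 c, C c & pr [set o | e <= p (y - c) o] < e].

Let mle (e : R) x : measurable [set o | e <= p x o].
Proof. exact: (measurable_lef (cst e) (p x)). Qed.

Lemma subset_prob_closure C : C `<=` prob_closure C.
Proof.
move=> y Cy e e0; exists y => //; rewrite subrr.
apply: (le_lt_trans _ e0); rewrite -(pr0 P); apply: pr_sub_ae => //.
have [_ pZ _] := p_seminorm.
apply: filterS (pZ 0 0) => o; rewrite scaler0 => po /=.
by rewrite po mfunE normr0 mul0r leNgt e0.
Qed.

Lemma prob_closure_convex C : mfun_convex C -> mfun_convex (prob_closure C).
Proof.
move=> Cconv x y a Cx Cy a01 e e0.
have [_ pZ pD] := p_seminorm.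
have e20 : 0 < e / 2 by rewrite divr_gt0.
have [c Cc xc] := Cx _ e20; have [c' Cc' yc'] := Cy _ e20.
exists (a *: c + (1 - a) *: c'); first exact: Cconv.
have -> : a *: x + (1 - a) *: y - (a *: c + (1 - a) *: c') =
    a *: (x - c) + (1 - a) *: (y - c').
  by rewrite !scalerBr opprD addrACA.
apply: (@le_lt_trans _ _ (pr [set o | e / 2 <= p (x - c) o] +
    pr [set o | e / 2 <= p (y - c') o])); last by move: xc yc'; lra.
apply: pr_le_ae => //.
near=> o => /= eo.
have h1 : p (a *: (x - c) + (1 - a) *: (y - c')) o <=
    p (a *: (x - c)) o + p ((1 - a) *: (y - c')) o by near: o; exact: pD.
have h2 : p (a *: (x - c)) o = `|a o| * p (x - c) o by near: o; exact: pZ.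
have h3 : p ((1 - a) *: (y - c')) o = `|(1 - a) o| * p (y - c') o.
  by near: o; exact: pZ.
have /andP[a0 a1] := a01 o.
move: h1; rewrite h2 h3 !mfunE (ger0_norm a0) ger0_norm; last by lra.
move=> h1; apply/orP; rewrite -implyNb; apply/implyP; rewrite -ltNge => h4.
rewrite leNgt; apply/negP => h5.
by have := ler_wpM2l a0 (ltW h4); nra.
Unshelve. all: by end_near. Qed.

Lemma prob_closureC_open C y : ~ prob_closure C y -> exists e : R, 0 < e /\
  forall z, pr [set o | e <= p (z - y) o] < e -> ~ prob_closure C z.
Proof.
move=> /existsNP[e /not_implyP[e0 /forall2NP yC]].
exists (e / 2); split; first by rewrite divr_gt0.
move=> z zy /(_ (e / 2))[|c Cc zc]; first by rewrite divr_gt0.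
have [//|] := yC c; apply.
apply: (@le_lt_trans _ _ (pr [set o | e / 2 <= p (z - c) o] +
    pr [set o | e / 2 <= p (z - y) o])); last by move: zc zy; lra.
apply: pr_le_ae => //.
have : {ae P, forall o, p (y - c) o <= p (z - c) o + p (z - y) o}.
  apply: filterS (seminormB p_seminorm (z - c) (z - y)) => o.
  by rewrite opprB addrC addrA subrK.
apply: filterS => o h /= eo.
have [|zco] := leP (e / 2) (p (z - c) o); [by left|right].
by move: h eo; lra.
Qed.

End LimitPoints.

Theorem theorem3p1 (R : realType) (d : measure_display) (Omega : measurableType d)
  (P : probability Omega R) (kc : bool) (E : zmodType)
  (smul : (Omega -> R[i]) -> E -> E) (I : Type) (nrm : I -> E -> Omega -> R)
  (HE : is_RLC_module P kc smul nrm) (G : set E)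
  (HGconv : L0_convex P smul G)
  (HGcomp : L0_convexly_compact P smul nrm G) :
  as_bounded P nrm G.
Proof.
case: E smul nrm HE G HGconv HGcomp => T classT.
set E : zmodType := GRing.Zmodule.Pack classT.
move=> smul nrm HE G HGconv HGcomp i.
have [[smul_ae smulDr smulDl smulM smul1] Hnrm _] := HE.
have [nrm0 nrmZ nrmD] := Hnrm i.

(* Real random variables are scalars for both choices of K, so the real module structure serves both
   cases. *)
have KrvL (a : {mfun Omega >-> R}) : Krv kc (kofR a).
  by split => //=; exact: measurable_funPT.
pose scale (a : {mfun Omega >-> R}) (x : E) := smul (kofR a) x.
have scaleA (a b : {mfun Omega >-> R}) x : scale a (scale b x) = scale (a * b) x.
  rewrite /scale -smulM//; congr smul; apply/funext => o.
  by rewrite /kmul /kofR mfunE rmorphM.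
have scale1 : left_id 1 scale by move=> x; rewrite -[RHS]smul1; congr smul.
have scaleDr : right_distributive scale +%R.
  by move=> a x y; exact: smulDr.
have scaleDl x : {morph scale^~ x : a b / a + b}.
  move=> a b; rewrite /scale -smulDl//; congr smul; apply/funext => o.
  by rewrite /kadd /kofR mfunE rmorphD.
(* Over the ring of measurable functions, representatives of L^0, the module
   axioms hold strictly; almost sure equality only enters through the norm. *)
pose E_lmodule := GRing.Zmodule_isLmodule.Build {mfun Omega >-> R} E
  scaleA scale1 scaleDr scaleDl.
pose V : lmodType {mfun Omega >-> R} :=
  HB.pack_for (lmodType {mfun Omega >-> R}) (GRing.Zmodule.sort E) E_lmodule.
pose p (x : V) : {mfun Omega >-> R} := HB.pack (nrm i x)
  (isMeasurableFun.Build _ _ _ _ (nrm i x) (nrm0 x).1).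
have p_seminorm : mfun_seminorm P p.
  split; [by move=> x; exact: (nrm0 x).2| |by move=> x y; exact: nrmD].
  move=> a x; apply: filterS (nrmZ _ x (KrvL a)) => o.
  by rewrite /cabs /= expr0n addr0 sqrtr_sqr.
have G_convex : mfun_convex (G : set V).
  move=> x y a Gx Gy a01; apply: (HGconv x y a) => //.
  - exact: measurable_funPT.
  - by apply: aeW => o; have /andP[] := a01 o.
  - by apply: aeW => o; have /andP[] := a01 o.
have L0_convexW (C : set V) : mfun_convex C -> L0_convex P smul C.
  move=> Cconv x y xi Cx Cy mxi xi0 xi1.
  (* [xi] lies in [0,1] only almost surely; its truncation does so everywhere and acts in the same
     way on [E]. *)
  pose a0 : {mfun Omega >-> R} := HB.pack xi (isMeasurableFun.Build _ _ _ _ xi mxi).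
  pose a : {mfun Omega >-> R} := min_mfun (max_mfun a0 0) 1.
  have aE : {ae P, forall o, xi o = a o}.
    apply: filterS2 xi0 xi1 => o x0 x1.
    by rewrite /a /= (max_idPl _)// (min_idPl _).
  have -> : smul (kofR xi) x = smul (kofR a) x.
    apply: smul_ae; [by split|exact: KrvL|].
    by apply: filterS aE => o; rewrite /kofR => ->.
  have -> : smul (kofR (fun o => 1 - xi o)) y =
      smul (kofR (1 - a : {mfun Omega >-> R})) y.
    apply: smul_ae; [|exact: KrvL|].
      by split => //=; exact: measurable_funB.
    by apply: filterS aE => o; rewrite /kofR mfunE => ->.
  apply: (Cconv x y a) => // o.
  by rewrite /a /= le_min ler01 le_max lexx orbT ge_min lexx orbT.
have G_compact : nested_convex_compact P p G.
  move=> C CP.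
  have Cmono m n : (m <= n)%N -> C n `<=` C m.
    elim: n => [|n ih]; first by rewrite leqn0 => /eqP ->.
    rewrite leq_eqVlt => /predU1P[->//|/ih{}ih x Cx].
    by apply: ih; have [_ _ _] := CP n; apply.
  (* Compactness is applied to the closures of the [C n] within [G]; since the [C n] are nested and
     nonempty, the finite intersection property holds. *)
  have [||x [_ xP]] := HGcomp.2 [set prob_closure P p (C n) `&` (G : set V) | n in setT].
  - move=> _ [n _ <-]; have [_ Cconv _ _] := CP n.
    split; first exact: subIsetr.
      apply: L0_convexW => x y a [Cx Gx] [Cy Gy] a01.
      by split; [exact: prob_closure_convex|exact: G_convex].
    exists (prob_closure P p (C n)); split => //.
    move=> y /(prob_closureC_open p_seminorm)[e [e0 yC]].
    (* The bound 1/2 ensures lam < 1, and lam <= e turns a probability above 1 - lam into an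
       exceptional event smaller than e. *)
    pose lam := Num.min e 2^-1.
    exists [:: i], e, lam; split => //.
    + by rewrite lt_min e0 invr_gt0 ltr0n.
    + by rewrite gt_min invf_lt1 ?ltr1n ?ltr0n ?orbT.
    + move=> z; rewrite /Unbhd /= => zy; apply: yC.
      have mz := measurable_lef (cst e) (p (z - y)).
      have nE : [set o | nrmQ nrm [:: i] (z - y) o < e] =
          ~` [set o | e <= p (z - y) o].
        by apply/seteqP; split => o /=;
          rewrite /nrmQ big_cons big_nil gt_max e0 andbT ltNge => /negP.
      move: zy; rewrite nE probability_setC// prE// -EFinB lte_fin.
      have : lam <= e by rewrite ge_min lexx.
      by lra.
  - move=> s sF.
    have [N NP] : exists N, forall A, List.In A s -> C N `<=` A.
      elim: s sF => [|A s ih] sF; first by exists 0%N.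
      have [N NP] := ih (fun B Bs => sF B (or_intror Bs)).
      have [n _ nA] := sF A (or_introl erefl).
      exists (maxn n N) => B [<-|Bs].
        rewrite -nA => x /(Cmono _ _ (leq_maxl n N)) Cx.
        split; first exact: subset_prob_closure.
        by have [_ _ CG _] := CP n; exact: CG.
      by move=> x /(Cmono _ _ (leq_maxr n N)) Cx; exact: (NP B).
    have [[x Cx] _ CG _] := CP N.
    by exists x; split; [exact: CG|move=> A As; exact: (NP A)].
  - by exists x => n; have [] := xP _ (ex_intro2 _ _ n Logic.I erefl).
have [M MP] := compact_seminorm_dominated p_seminorm G_compact G_convex.
exists (max_mfun M 0); split; first split.
- exact: measurable_funPT.
- by apply: aeW => o /=; rewrite le_max lexx orbT.
- by move=> g Gg; apply: filterS (MP g Gg) => o; rewrite /= le_max => ->.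
Qed.
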